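(* For all $n \in \omega$, the $n$th iterated hyperjump $\mathcal{O}^{(n)}$ is not $2$-generic relative to any perfect tree.
   Context: A real is an element of $2^\omega$, identified with a subset of $\omega$. A perfect tree is a nonempty set $T \subseteq 2^{<\omega}$ closed under initial segments such that every $\sigma \in T$ has two incompatible extensions in $T$. A real $X$ is a path through $T$ if $X|k \in T$ for all $k$, where $X|k$ is the initial segment of $X$ of length $k$. A real $X$ is $2$-generic relative to a perfect tree $T$ if $X$ is a path through $T$ and for every $\Sigma^0_2(T)$ set $S$ of finite binary strings there is a $k$ such that either $X|k \in S$ or $\sigma \notin S$ for every $\sigma \in T$ extending $X|k$. For a real $X$, let $U^X_e$ denote the $e$th tree in $\omega^{<\omega}$ recursive in $X$, in a fixed standard effective indexing: membership $\sigma \in U^X_e$ is decidable from $X$ uniformly in $e,\sigma$; from an index of any $X$-recursive tree one can effectively find $e$ such that $U^X_e$ has the same infinite paths as that tree; and there is a recursive function $h$ with $U^X_{h(e,\gamma)} = \{\sigma \in U^X_e : \sigma \subseteq \gamma \text{ or } \sigma \supseteq \gamma\}$ for all $e,\gamma$. The hyperjump of $X$ is $\mathcal{O}^X = \{e : U^X_e \text{ is well-founded (has no infinite path)}\}$, and $\mathcal{O} = \mathcal{O}^{\emptyset}$. The iterates are $\mathcal{O}^{(0)} = \emptyset$ and $\mathcal{O}^{(n+1)} = \mathcal{O}^{\mathcal{O}^{(n)}}$, so $\mathcal{O}^{(1)} = \mathcal{O}$. *)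

(* Defs.v *)
From mathcomp Require Import all_boot.
From mathcomp Require Import boolp classical_sets.
From Stdlib Require Cantor.

Set Implicit Arguments.
Unset Strict Implicit.
Unset Printing Implicit Defensive.

Local Open Scope classical_set_scope.

Definition real := nat -> bool.

Definition empty_real : real := fun=> false.

(** ** Recursiveness relative to an oracle *)

Definition npair (a b : nat) : nat := Cantor.to_nat (a, b).

Fixpoint seq_code (s : seq nat) : nat :=
  if s is a :: t then (npair a (seq_code t)).+1 else 0.

Definition str_code (s : seq bool) : nat := seq_code (map nat_of_bool s).

(* Programs for the partial functions from nat to nat that are recursive in an
   oracle; functions of several arguments act on Cantor pairs. *)
Inductive prog : Type :=
| Zero | Succ | Fst | Snd | Oracle
| Pair of prog & prog
| Comp of prog & prog
| Prec of prog & prog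
| Mu of prog.

(* [eval X c n m]: with oracle X, program c halts on input n with output m. *)
Inductive eval (X : real) : prog -> nat -> nat -> Prop :=
| eval_Zero n : eval X Zero n 0
| eval_Succ n : eval X Succ n n.+1
| eval_Fst n : eval X Fst n (Cantor.of_nat n).1
| eval_Snd n : eval X Snd n (Cantor.of_nat n).2
| eval_Oracle n : eval X Oracle n (X n)
| eval_Pair c d n a b :
    eval X c n a -> eval X d n b -> eval X (Pair c d) n (npair a b)
| eval_Comp c d n a b :
    eval X d n a -> eval X c a b -> eval X (Comp c d) n b
| eval_Prec0 c d a v :
    eval X c a v -> eval X (Prec c d) (npair a 0) v
| eval_PrecS c d a k v w :
    eval X (Prec c d) (npair a k) v ->
    eval X d (npair a (npair k v)) w ->
    eval X (Prec c d) (npair a k.+1) w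
| eval_Mu c a k (w : nat -> nat) :
    (forall j, j < k -> eval X c (npair a j) (w j).+1) ->
    eval X c (npair a k) 0 ->
    eval X (Mu c) a k.

(* The index (Gödel number) of a program. *)
Fixpoint index_of (c : prog) : nat :=
  match c with
  | Zero => 0
  | Succ => 1
  | Fst => 2
  | Snd => 3
  | Oracle => 4
  | Pair c d => 5 + 4 * npair (index_of c) (index_of d)
  | Comp c d => 6 + 4 * npair (index_of c) (index_of d)
  | Prec c d => 7 + 4 * npair (index_of c) (index_of d)
  | Mu c => 8 + 4 * index_of c
  end.

(** ** Trees and paths *)

Definition is_tree (A : eqType) (T : set (seq A)) : Prop :=
  forall s t, prefix s t -> T t -> T s.

(* [mkseq f k] is the initial segment of f of length k. *)
Definition paths (A : eqType) (T : set (seq A)) : set (nat -> A) :=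
  [set f | forall k, T (mkseq f k)].

Definition perfect_tree (T : set (seq bool)) : Prop :=
  [/\ T !=set0, is_tree T &
      forall s, T s -> exists t1 t2,
        [/\ T t1, T t2, prefix s t1, prefix s t2 &
            ~~ prefix t1 t2 && ~~ prefix t2 t1]].

(** ** Genericity relative to a perfect tree *)

(* A set of strings used as an oracle. *)
Definition str_oracle (T : set (seq bool)) : real :=
  fun n => `[< exists2 s, T s & str_code s = n >].

Definition Sigma02 (X : real) (S : set (seq bool)) : Prop :=
  exists (R : seq bool -> nat -> nat -> bool) (c : prog),
    (forall s a b, eval X c (npair (str_code s) (npair a b)) (R s a b)) /\
    S = [set s | exists a, forall b, R s a b].

Definition two_generic (T : set (seq bool)) (X : real) : Prop :=
  paths T X /\
  forall S, Sigma02 (str_oracle T) S ->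
    exists k, S (mkseq X k) \/
      forall s, T s -> prefix (mkseq X k) s -> ~ S s.

(** ** Hyperjump *)

Definition decides_tree (X : real) (c : prog) (W : set (seq nat)) : Prop :=
  forall s, eval X c (seq_code s) `[< W s >].

(* [V] is an effective indexing of the trees in omega^{<omega} recursive in X:
   membership is decided by one program with oracle X, while passing from an
   index of an X-recursive tree to its place in the indexing, and restricting a
   tree to the strings comparable with a given one, are recursive (no oracle).
   For a family U of indexings, one for each X, it is not demanded that these
   programs be independent of X; indexings that are also uniform in X are thus
   a special case. *)
Definition effective_tree_indexing (X : real) (V : nat -> set (seq nat)) : Prop :=
  [/\ forall e, is_tree (V e),
      exists d : prog, forall e s,
        eval X d (npair e (seq_code s)) `[< V e s >],
      exists t : prog, forall (c : prog) (W : set (seq nat)),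
        is_tree W -> decides_tree X c W ->
        exists2 e, eval empty_real t (index_of c) e & paths (V e) = paths W &
      exists (h : nat -> seq nat -> nat) (r : prog),
        (forall e g, eval empty_real r (npair e (seq_code g)) (h e g)) /\
        (forall e g, V (h e g) = [set s | V e s /\ (prefix s g || prefix g s)])].

Definition hyperjump (U : real -> nat -> set (seq nat)) (X : real) : real :=
  fun e => `[< paths (U X e) = set0 >].

Definition iter_hyperjump (U : real -> nat -> set (seq nat)) (n : nat) : real :=
  iter n (hyperjump U) empty_real.

(* Main.v *)
Require Import Defs.
From mathcomp Require Import all_boot.
From mathcomp Require Import boolp classical_sets.
From Stdlib Require Cantor.

(** Write [A] for the tree [T] used as an oracle, and let [X], the [n]th iterated
    hyperjump, be 2-generic relative to [T].  The contradiction has two halves.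

    A generic real is not computable in [A]: if it were, genericity would make
    all strings of [T] above some initial segment of [X] agree with [X], while
    a perfect tree splits there ([generic_not_computable]).

    But every iterate [Y_m], for [m <= n], is computable in [A], by induction on
    [m].  For the step, [Y_{m+1}] is the hyperjump of [Y = Y_m] and is many-one
    reducible to [X] ([reducible_iter_hyperjump]), so a string [s] of [T] makes
    claims, true or false, that trees computable in [Y] are well-founded (bit
    1) or ill-founded (bit 0).  What [X] itself claims is true.  Hence, each
    time [X] claims that the part of a tree comparable with a node is
    ill-founded, a longer initial segment of [X] makes the same claim for a
    proper extension of the node.  The induction hypothesis makes membership in
    the tree computable in [A], so this regularity is simple enough for
    genericity to pass it on to all strings of [T] above some [X|k]; from such a
    string one can climb through longer and longer nodes, so every claim of
    ill-foundedness made above [X|k] is true.  A second use of genericity yields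
    a [k'] such that above [X|k'] no string calls well-founded a tree which some
    string above [X|k] calls ill-founded, so claims of well-foundedness made
    above both [X|k] and [X|k'] are true as well.  Searching [T] for any such
    string that decides [e] now computes the hyperjump of [Y] from [A]
    ([hyperjump_computable]). *)

Set Implicit Arguments.
Unset Strict Implicit.
Unset Printing Implicit Defensive.

Local Open Scope classical_set_scope.

(** * Functions computable in an oracle *)

Definition nfst (n : nat) : nat := (Cantor.of_nat n).1.
Definition nsnd (n : nat) : nat := (Cantor.of_nat n).2.

Lemma npairK1 (a b : nat) : nfst (npair a b) = a.
Proof. by rewrite /nfst /npair Cantor.cancel_of_to. Qed.

Lemma npairK2 (a b : nat) : nsnd (npair a b) = b.
Proof. by rewrite /nsnd /npair Cantor.cancel_of_to. Qed.

Lemma npair_nfst_nsnd (n : nat) : npair (nfst n) (nsnd n) = n.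
Proof.
by rewrite /npair /nfst /nsnd -surjective_pairing Cantor.cancel_to_of.
Qed.

Definition npairE := (npairK1, npairK2).

Definition computable (A : real) (f : nat -> nat) : Prop :=
  exists c, forall n, eval A c n (f n).

Definition computable2 (A : real) (F : nat -> nat -> nat) : Prop :=
  computable A (fun n => F (nfst n) (nsnd n)).

Lemma eq_computable (A : real) (f g : nat -> nat) :
  f =1 g -> computable A f -> computable A g.
Proof. by move=> fg [c hc]; exists c => n; rewrite -fg. Qed.

(** A computation with oracle [X] becomes one with oracle [Z] once a program
    that computes [X] from [Z] replaces the oracle calls. *)
Lemma computable_trans (X Z : real) (f : nat -> nat) :
  computable Z (fun n => X n) -> computable X f -> computable Z f.
Proof.
move=> [p hp] [c hc].
pose fix subst c := match c with
  | Oracle => p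
  | Pair c d => Pair (subst c) (subst d)
  | Comp c d => Comp (subst c) (subst d)
  | Prec c d => Prec (subst c) (subst d)
  | Mu c => Mu (subst c)
  | c => c
  end.
exists (subst c) => n; elim: {c hc}(hc n) => /=; try by constructor.
- by move=> k; apply: hp.
- by move=> c d k a b _ h1 _ h2; apply: eval_Comp h1 h2.
- by move=> c d a k v w _ h1 _ h2; apply: eval_PrecS h1 h2.
- by move=> c a k w _ h1 _ h2; apply: eval_Mu h1 h2.
Qed.

Lemma computable_id (A : real) : computable A (fun n => n).
Proof.
exists (Pair Fst Snd) => n; rewrite -{2}(npair_nfst_nsnd n).
by constructor; constructor.
Qed.

Lemma computable_comp (A : real) (F f : nat -> nat) :
  computable A F -> computable A f -> computable A (fun n => F (f n)).
Proof.
by move=> [c hc] [d hd]; exists (Comp c d) => n; apply: eval_Comp (hd n) (hc _).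
Qed.

Lemma computable_succ (A : real) (f : nat -> nat) :
  computable A f -> computable A (fun n => (f n).+1).
Proof. by apply: computable_comp; exists Succ; constructor. Qed.

Lemma computable_const (A : real) (k : nat) : computable A (fun=> k).
Proof.
elim: k => [|k IH]; first by exists Zero; constructor.
exact: computable_succ IH.
Qed.

Lemma computable_nfst (A : real) (f : nat -> nat) :
  computable A f -> computable A (fun n => nfst (f n)).
Proof. by apply: computable_comp; exists Fst; constructor. Qed.

Lemma computable_nsnd (A : real) (f : nat -> nat) :
  computable A f -> computable A (fun n => nsnd (f n)).
Proof. by apply: computable_comp; exists Snd; constructor. Qed.

Lemma computable_npair (A : real) (f g : nat -> nat) :
  computable A f -> computable A g -> computable A (fun n => npair (f n) (g n)).
Proof.
by move=> [c hc] [d hd]; exists (Pair c d) => n; constructor.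
Qed.

Lemma computable_oracle (A : real) (f : nat -> nat) :
  computable A f -> computable A (fun n => A (f n)).
Proof.
apply: (@computable_comp A (fun n => A n)).
by exists Oracle; constructor.
Qed.

Lemma computable_comp2 (A : real) (F : nat -> nat -> nat) (f g : nat -> nat) :
  computable2 A F -> computable A f -> computable A g ->
  computable A (fun n => F (f n) (g n)).
Proof.
move=> cF cf cg.
apply: (eq_computable _ (computable_comp cF (computable_npair cf cg))) => n.
by rewrite !npairE.
Qed.

Lemma computable_nat_rec (A : real) (s : nat -> nat -> nat -> nat)
    (b m : nat -> nat) :
  computable A b ->
  computable A (fun n => s (nfst n) (nfst (nsnd n)) (nsnd (nsnd n))) ->
  computable A m ->
  computable A (fun n => nat_rec (fun=> nat) (b n) (s n) (m n)).
Proof.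
move=> [cb hb] [cs hs] [cm hm].
have [ci hi] := computable_id A.
exists (Comp (Prec cb cs) (Pair ci cm)) => n.
apply: eval_Comp; first by constructor; [exact: hi | exact: hm].
elim: (m n) => [|k IH]; first by constructor.
apply: eval_PrecS IH _.
by have := hs (npair n (npair k (nat_rec _ (b n) (s n) k))); rewrite !npairE.
Qed.

Lemma computable_iter (A : real) (s : nat -> nat -> nat) (b m : nat -> nat) :
  computable2 A s -> computable A b -> computable A m ->
  computable A (fun n => iter (m n) (s n) (b n)).
Proof.
move=> cs cb cm.
apply: (@eq_computable _
  (fun n => nat_rec (fun=> nat) (b n) (fun _ v => s n v) (m n))) => [n|].
  by elim: (m n) => //= k ->.
apply: (@computable_nat_rec _ (fun n _ v => s n v)) => //.
by apply: (computable_comp2 cs); do ?apply: computable_nfst;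
  do ?apply: computable_nsnd; apply: computable_id.
Qed.

Lemma computable_if (A : real) (p : nat -> bool) (f g : nat -> nat) :
  computable A p -> computable A f -> computable A g ->
  computable A (fun n => if p n then f n else g n).
Proof.
move=> cp cf cg.
apply: (@eq_computable _
  (fun n => nat_rec (fun=> nat) (g n) (fun _ _ => f n) (p n))) => [n|].
  by case: (p n).
apply: (@computable_nat_rec _ (fun n _ _ => f n)) => //.
by apply: (computable_comp cf); apply: computable_nfst; apply: computable_id.
Qed.

Lemma computable_negb (A : real) (p : nat -> bool) :
  computable A p -> computable A (fun n => ~~ p n).
Proof.
move=> cp; apply: (@eq_computable _ (fun n => if p n then 0 else 1)) => [n|].
  by case: (p n).
by apply: computable_if => //; apply: computable_const.
Qed.

Lemma computable_andb (A : real) (p q : nat -> bool) :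
  computable A p -> computable A q -> computable A (fun n => p n && q n).
Proof.
move=> cp cq; apply: (@eq_computable _ (fun n => if p n then nat_of_bool (q n) else 0)) => [n|].
  by case: (p n).
by apply: computable_if => //; apply: computable_const.
Qed.

Lemma computable_orb (A : real) (p q : nat -> bool) :
  computable A p -> computable A q -> computable A (fun n => p n || q n).
Proof.
move=> cp cq; apply: (@eq_computable _ (fun n => if p n then 1 else nat_of_bool (q n))) => [n|].
  by case: (p n).
by apply: computable_if => //; apply: computable_const.
Qed.

Lemma computable_predn (A : real) (f : nat -> nat) :
  computable A f -> computable A (fun n => (f n).-1).
Proof.
move=> cf; apply: (@eq_computable _
  (fun n => nat_rec (fun=> nat) 0 (fun k _ => k) (f n))) => [n|].
  by case: (f n).
apply: (@computable_nat_rec _ (fun _ k _ => k)) => //.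
  exact: computable_const.
by apply: computable_nfst; apply: computable_nsnd; apply: computable_id.
Qed.

Lemma computable_addn (A : real) (f g : nat -> nat) :
  computable A f -> computable A g -> computable A (fun n => f n + g n).
Proof.
move=> cf cg; apply: (@eq_computable _ (fun n => iter (f n) succn (g n))) => [n|].
  by rewrite iter_succn addnC.
apply: (@computable_iter _ (fun=> succn)) => //.
by apply: computable_succ; apply: computable_nsnd; apply: computable_id.
Qed.

Lemma computable_subn (A : real) (f g : nat -> nat) :
  computable A f -> computable A g -> computable A (fun n => f n - g n).
Proof.
move=> cf cg; apply: (@eq_computable _ (fun n => iter (g n) predn (f n))) => [n|].
  by rewrite iter_predn.
apply: (@computable_iter _ (fun=> predn)) => //.
by apply: computable_predn; apply: computable_nsnd; apply: computable_id.
Qed.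

Lemma computable_eqn (A : real) (f g : nat -> nat) :
  computable A f -> computable A g -> computable A (fun n => f n == g n).
Proof.
move=> cf cg.
pose isz k := nat_rec (fun=> nat) 1 (fun _ _ => 0) k.
apply: (@eq_computable _ (fun n => isz ((f n - g n) + (g n - f n)))) => [n|].
  rewrite eqn_leq -!subn_eq0 -addn_eq0.
  by case: (_ + _).
apply: (@computable_nat_rec _ (fun _ _ _ => 0)); try exact: computable_const.
by apply: computable_addn; apply: computable_subn.
Qed.

Lemma computable_all (A : real) (p : nat -> nat -> bool) (m : nat -> nat) :
  computable2 A (fun a b => p a b) -> computable A m ->
  computable A (fun n => all (p n) (iota 0 (m n))).
Proof.
move=> cp cm.
apply: (@eq_computable _ (fun n =>
  nat_rec (fun=> nat) 1 (fun k v => (v != 0) && p n k) (m n))) => [n|].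
  elim: (m n) => // k IH.
  have -> : all (p n) (iota 0 k.+1) = all (p n) (iota 0 k) && p n k.
    by rewrite -addn1 iotaD all_cat /= andbT.
  by rewrite /= IH; case: (all _ _).
apply: (@computable_nat_rec _ (fun n k v => (v != 0) && p n k)) => //.
  exact: computable_const.
have cid := computable_id A.
apply: computable_andb.
  apply: computable_negb; apply: computable_eqn; last exact: computable_const.
  by do 2 apply: computable_nsnd.
apply: (computable_comp2 cp); first exact: computable_nfst.
by apply: computable_nfst; apply: computable_nsnd.
Qed.

(** An unbounded search finds some witness; which one does not matter, since
    they all yield the same value. *)
Lemma computable_search (A : real) (p : nat -> nat -> bool)
    (q : nat -> nat -> nat) (f : nat -> nat) :
  computable2 A (fun a b => p a b) -> computable2 A q ->
  (forall n, exists k, p n k) -> (forall n k, p n k -> q n k = f n) ->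
  computable A f.
Proof.
move=> cp cq ex pq.
pose m n := ex_minn (ex n).
apply: (@eq_computable _ (fun n => q n (m n))) => [n|].
  by apply: pq; rewrite /m; case: ex_minnP.
apply: (computable_comp2 cq); first exact: computable_id.
have [c hc] := computable_negb cp.
exists (Mu c) => n; rewrite /m; case: ex_minnP => k pk min.
apply: (@eval_Mu _ _ _ _ (fun=> 0)) => [j jk|]; last first.
  by have := hc (npair n k); rewrite !npairE pk.
have := hc (npair n j); rewrite !npairE.
by case: (boolP (p n j)) => // /min; rewrite leqNgt jk.
Qed.

(** Proves that a composition of the functions above, and of functions assumed
    computable, is computable.  The weaker [simple apply] keeps unification from
    unfolding definitions such as [asbool], behind which it would find spurious
    conditionals; abstracting over [f] and [g] lets it solve for them by
    higher-order patterns. *)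
Ltac computability := repeat first
  [ assumption
  | simple apply computable_id
  | simple apply computable_const
  | simple apply computable_andb
  | simple apply computable_orb
  | simple apply computable_negb
  | simple apply computable_eqn
  | simple apply computable_addn
  | simple apply computable_succ
  | simple apply computable_predn
  | simple apply computable_npair
  | simple apply computable_nfst
  | simple apply computable_nsnd
  | match goal with
    | H : computable2 ?A ?F |- computable ?A _ =>
        simple apply (fun f g => @computable_comp2 A F f g H)
    | H : computable ?A ?F |- computable ?A _ =>
        simple apply (fun f => @computable_comp A F f H)
    end ].

(** * Codes of strings *)

Lemma seq_code_inj : injective seq_code.
Proof.
elim=> [|a s IH] [|b t] //= [] e.
have := congr1 nfst e; rewrite !npairE => ->.
by have := congr1 nsnd e; rewrite !npairE => /IH ->.
Qed.

Lemma seq_code_surj (n : nat) : exists s, seq_code s = n.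
Proof.
elim/ltn_ind: n => -[_|n IH]; first by exists [::].
have [|s hs] := IH (nsnd n); last first.
  by exists (nfst n :: s); rewrite /= hs npair_nfst_nsnd.
rewrite ltnS -{2}(npair_nfst_nsnd n); apply/leP.
have := Cantor.to_nat_non_decreasing (nfst n) (nsnd n).
by move=> /leP; rewrite plusE => h; apply/leP; apply: leq_trans h; apply: leq_addr.
Qed.

Definition seq_decode (n : nat) : seq nat := projT1 (cid (seq_code_surj n)).

Lemma seq_decodeK : cancel seq_decode seq_code.
Proof. by move=> n; rewrite /seq_decode; case: cid. Qed.

Lemma seq_codeK : cancel seq_code seq_decode.
Proof. by move=> s; apply: seq_code_inj; rewrite seq_decodeK. Qed.

Lemma str_code_inj : injective str_code.
Proof.
by move=> s t /seq_code_inj; apply: inj_map => -[] [].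
Qed.

Lemma leq_size_seq_code (s : seq nat) : size s <= seq_code s.
Proof.
elim: s => //= a s IH; rewrite ltnS; apply: leq_trans IH _.
have /leP := Cantor.to_nat_non_decreasing a (seq_code s).
by rewrite plusE; apply: leq_trans; apply: leq_addr.
Qed.

(** The entry at position [j] of the string with code [c], increased by one
    so that [0] can stand for a position beyond the end. *)
Definition code_nth (c j : nat) : nat :=
  let d := iter j (fun c => nsnd c.-1) c in
  if d == 0 then 0 else (nfst d.-1).+1.

Lemma code_nthE (s : seq nat) (j : nat) :
  code_nth (seq_code s) j = if j < size s then (nth 0 s j).+1 else 0.
Proof.
have tailE (t : seq nat) : nsnd (seq_code t).-1 = seq_code (behead t).
  by case: t => //= a t; rewrite npairE.
rewrite /code_nth; elim: j s => [|j IH] s.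
  by case: s => //= a s; rewrite npairE.
by rewrite iterSr tailE IH; case: s => //= ; rewrite ltn0.
Qed.

Lemma code_nth_str (s : seq bool) (j : nat) :
  code_nth (str_code s) j = if j < size s then (nth false s j : nat).+1 else 0.
Proof.
by rewrite code_nthE size_map; case: ifP => // js; rewrite (nth_map false).
Qed.

Lemma computable_code_nth (A : real) : computable2 A code_nth.
Proof.
rewrite /computable2 /code_nth.
have cd : computable A (fun n => iter (nsnd n) (fun c => nsnd c.-1) (nfst n)).
  apply: (@computable_iter _ (fun _ c => nsnd c.-1)); rewrite /computable2;
  computability.
by apply: computable_if; computability.
Qed.

(** A code bounds the length of its string, so testing the positions below [x]
    is enough. *)
Definition code_prefix (x y : nat) : bool :=
  all (fun j => (code_nth x j == 0) || (code_nth x j == code_nth y j)) (iota 0 x).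

Lemma code_prefixE (s t : seq nat) :
  code_prefix (seq_code s) (seq_code t) = prefix s t.
Proof.
apply/allP/idP => [h | /prefixP [u ->] j _]; last first.
  rewrite !code_nthE size_cat nth_cat; case: ltnP => // js.
  by rewrite ltn_addr ?eqxx ?orbT.
have hn j : j < size s -> j < size t /\ nth 0 s j = nth 0 t j.
  move=> js; have := h j; rewrite mem_iota add0n /=.
  move=> /(_ (leq_trans js (leq_size_seq_code s))).
  by rewrite !code_nthE js /=; case: ltnP => // _ /eqP [].
have st : size s <= size t.
  by case: leqP => // /[dup] /hn []; rewrite ltnn.
rewrite prefixE; apply/eqP/(@eq_from_nth _ 0); first by rewrite size_takel.
by move=> j; rewrite size_takel // => js; rewrite nth_take //; case: (hn j js).
Qed.

Lemma code_prefix_str (s t : seq bool) :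
  code_prefix (str_code s) (str_code t) = prefix s t.
Proof.
rewrite code_prefixE; elim: s t => [|a s IH] [|b t] //=.
by rewrite IH; case: a; case: b.
Qed.

Lemma computable_code_prefix (A : real) :
  computable2 A (fun x y => code_prefix x y).
Proof.
apply: (@computable_all _ (fun n j => (code_nth (nfst n) j == 0) ||
   (code_nth (nfst n) j == code_nth (nsnd n) j))); last by computability.
have cn := @computable_code_nth A.
by rewrite /computable2; computability.
Qed.

(** * Paths and generic reals *)

Lemma prefix_mkseq (A : eqType) (f : nat -> A) (k m : nat) :
  k <= m -> prefix (mkseq f k) (mkseq f m).
Proof. by move=> /subnKC <-; rewrite /mkseq iotaD map_cat prefix_prefix. Qed.

Lemma prefix_mkseq_nth (A : eqType) (x0 : A) (f : nat -> A) (s : seq A) :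
  (forall j, j < size s -> nth x0 s j = f j) -> s = mkseq f (size s).
Proof.
move=> h; apply: (@eq_from_nth _ x0); first by rewrite size_mkseq.
by move=> j js; rewrite nth_mkseq // h.
Qed.

Lemma prefix_nth (A : eqType) (x0 : A) (s t : seq A) (j : nat) :
  prefix s t -> j < size s -> nth x0 t j = nth x0 s j.
Proof. by move=> /prefixP [u ->]; rewrite nth_cat => ->. Qed.

(** The members of [D] play the part of the partial paths built so far: choosing
    extensions again and again, from any of them, yields an infinite path. *)
Lemma paths_of_extendible (W D : set (seq nat)) :
  is_tree W -> D !=set0 ->
  (forall g, D g -> exists g', [/\ D g', W g', prefix g g' & g != g']) ->
  paths W !=set0.
Proof.
move=> treeW [g0 Dg0] ext.
have [next hnext] := @choice {g | D g} {g | D g} (fun x y =>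
    [/\ W (sval y), prefix (sval x) (sval y) & sval x != sval y])
  (fun x => let: ex_intro g' (And4 Dg' Wg' pg ng) := ext _ (svalP x) in
    ex_intro _ (exist _ g' Dg') (And3 Wg' pg ng)).
pose G k := sval (iter k next (exist _ g0 Dg0)).
have Gstep k : prefix (G k) (G k.+1) by case: (hnext (iter k next (exist _ g0 Dg0))).
have Gmono k m : k <= m -> prefix (G k) (G m).
  move=> /subnKC <-; elim: (m - k) => [|i IH]; first by rewrite addn0 prefix_refl.
  by rewrite addnS; apply: prefix_trans IH (Gstep _).
have Gsize k : k <= size (G k).
  elim: k => // k IH; apply: leq_ltn_trans IH _.
  have [_ + ng] := hnext (iter k next (exist _ g0 Dg0)).
  rewrite -/(G k) -/(G k.+1) in ng *.
  move=> /prefixP [[|x u] e]; first by rewrite e cats0 eqxx in ng.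
  by rewrite e size_cat /= addnS ltnS leq_addr.
exists (fun j => nth 0 (G j.+1) j) => k.
apply: (treeW _ (G k.+1)); last by case: (hnext (iter k next (exist _ g0 Dg0))).
rewrite prefixE size_mkseq; apply/eqP/(@eq_from_nth _ 0).
  by rewrite size_mkseq size_takel //; apply: ltnW; apply: Gsize.
move=> j; rewrite size_takel; last by apply: ltnW; apply: Gsize.
move=> jk; rewrite nth_take // nth_mkseq //.
by apply: prefix_nth; [apply: Gmono; rewrite ltnS ltnW | apply: Gsize].
Qed.

Lemma str_oracleE (T : set (seq bool)) (s : seq bool) :
  str_oracle T (str_code s) = `[< T s >].
Proof.
apply/asboolP/asboolP => [[t Tt /str_code_inj <- //]|Ts]; by exists s.
Qed.

Lemma str_oracleP (T : set (seq bool)) (n : nat) :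
  str_oracle T n -> exists2 s, T s & n = str_code s.
Proof. by move=> /asboolP [s Ts <-]; exists s. Qed.

Lemma code_nth_mkseq (X : real) (k j : nat) :
  code_nth (str_code (mkseq X k)) j = if j < k then (X j : nat).+1 else 0.
Proof.
by rewrite code_nth_str size_mkseq; case: ifP => // jk; rewrite nth_mkseq.
Qed.

(** Genericity in the form in which it is applied.  The strings that violate the
    conclusion form a [Sigma02] set which contains no initial segment of [X]. *)
Lemma generic_forces (T : set (seq bool)) (X : real)
    (p : nat -> nat -> nat -> bool) :
  two_generic T X ->
  computable (str_oracle T)
    (fun n => p (nfst n) (nfst (nsnd n)) (nsnd (nsnd n))) ->
  (forall k a, exists b, p (str_code (mkseq X k)) a b) ->
  exists k, forall s, T s -> prefix (mkseq X k) s ->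
    forall a, exists b, p (str_code s) a b.
Proof.
move=> [_ gen] cp hp.
have [|k] := gen [set s | exists a, forall b, ~~ p (str_code s) a b].
  have [c hc] := computable_negb cp.
  exists (fun s a b => ~~ p (str_code s) a b), c; split => // s a b.
  by have := hc (npair (str_code s) (npair a b)); rewrite !npairE.
move=> [[a ha]|hk].
  by have [b pb] := hp k a; have := ha b; rewrite pb.
exists k => s Ts ks a; apply: contrapT => np; apply: (hk s Ts ks).
by exists a => b; apply/negP => pb; apply: np; exists b.
Qed.

(** If [X] were computable in the tree, then leaving [X] would be a [Sigma02]
    property of strings.  No initial segment of [X] has it, whereas a perfect
    tree branches off [X] above each of them. *)
Lemma generic_not_computable (T : set (seq bool)) (X : real) :
  perfect_tree T -> two_generic T X -> ~ computable (str_oracle T) (fun n => X n).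
Proof.
move=> [_ _ perf] gen cX; have [pathX _] := gen.
have cn := @computable_code_nth (str_oracle T).
have [||k hk] := @generic_forces T X (fun s j _ =>
    (code_nth s j == 0) || (code_nth s j == (X j).+1)) gen.
- by computability.
- by move=> k j; exists 0; rewrite code_nth_mkseq; case: ifP; rewrite // eqxx.
have on_path t : T t -> prefix (mkseq X k) t -> t = mkseq X (size t).
  move=> Tt kt; apply: (@prefix_mkseq_nth _ false) => j jt.
  have [_] := hk t Tt kt j; rewrite code_nth_str jt /= eqSS.
  by case: (nth _ _ _); case: (X j).
have [t1 [t2 [T1 T2 k1 k2]]] := perf _ (pathX k).
rewrite (on_path _ T1 k1) (on_path _ T2 k2).
by case: (leqP (size t1) (size t2)) => [|/ltnW] /(prefix_mkseq X) ->;
  rewrite ?andbF.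
Qed.

(** * Hyperjumps of reals computable in the tree *)

(** A path through the nodes comparable with [g] has to pass through [g]. *)
Lemma paths_comparable (W : set (seq nat)) (g : seq nat) (f : nat -> nat) :
  paths [set s | W s /\ (prefix s g || prefix g s)] f <->
  paths W f /\ g = mkseq f (size g).
Proof.
split=> [pf|[pf gE] k].
  split=> [k|]; first by case: (pf k).
  have [_] := pf (size g); rewrite !prefixE size_mkseq => /orP [] /eqP.
    by rewrite take_oversize.
  by rewrite take_oversize ?size_mkseq // => ->.
split; first exact: pf.
by rewrite gE; case: (leqP k (size g)) => [|/ltnW] /(prefix_mkseq f) ->;
  rewrite ?orbT.
Qed.

Lemma ill_foundedP (U : real -> nat -> set (seq nat)) (Y : real) (e : nat) :
  reflect (paths (U Y e) !=set0) (~~ hyperjump U Y e).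
Proof.
apply: (iffP (asboolPn _)) => [/eqP /set0P //|/set0P /eqP //].
Qed.

(** The claims that strings of the tree make about well-foundedness are forced to
    be true above some initial segment of [X], so that a search for any string
    above it that decides a question answers that question. *)
Lemma hyperjump_computable (U : real -> nat -> set (seq nat))
    (T : set (seq bool)) (X Y : real) (g : nat -> nat) :
  effective_tree_indexing Y (U Y) -> two_generic T X ->
  computable (str_oracle T) (fun n => Y n) ->
  computable (str_oracle T) g ->
  (forall e, hyperjump U Y e = X (g e)) ->
  computable (str_oracle T) (fun n => hyperjump U Y n).
Proof.
move=> [treeV [d hd] _ [h [r [hr hV]]]] gen cY cg XE.
set A := str_oracle T in cY cg *.
have cA : computable A (fun n => A n).
  by apply: computable_oracle; apply: computable_id.
have cV : computable2 A (fun e c => `[< U Y e (seq_decode c) >]).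
  apply: (computable_trans cY); exists d => n.
  by have := hd (nfst n) (seq_decode (nsnd n)); rewrite seq_decodeK npair_nfst_nsnd.
(* [w e c] is the place in [X] of the bit that tells whether the part of tree [e] comparable
   with the node [c] is well-founded. *)
pose w e c := g (h e (seq_decode c)).
have cw : computable2 A w.
  apply: (computable_comp cg).
  apply: (@computable_trans empty_real); first exact: computable_const.
  exists r => n.
  by have := hr (nfst n) (seq_decode (nsnd n)); rewrite seq_decodeK npair_nfst_nsnd.
have cn := @computable_code_nth A.
have cpre := @computable_code_prefix A.
have wE e s : ~~ X (w e (seq_code s)) <->
    exists2 f, paths (U Y e) f & s = mkseq f (size s).
  rewrite /w -XE seq_codeK; split.
    by move=> /ill_foundedP [f]; rewrite hV => /paths_comparable [pf sE];
      exists f.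
  by move=> [f pf sE]; apply/ill_foundedP; exists f; rewrite hV;
    apply/paths_comparable.
(* Forced by genericity: with [a] coding a pair [(e, c)], if [s] claims that
   tree [e] is ill-founded at the node [c], then some [b] coding a pair [(t, c')]
   consists of a string [t] of [T] extending [s] which makes the same claim at
   a proper extension [c'] of [c] inside tree [e]. *)
have [||k hk] := @generic_forces T X (fun s a b =>
    ~~ (code_nth s (w (nfst a) (nsnd a)) == 1) ||
    [&& A (nfst b), code_prefix s (nfst b), code_prefix (nsnd a) (nsnd b),
        ~~ (nsnd a == nsnd b),
        code_nth (nfst b) (w (nfst a) (nsnd b)) == 1 &
        `[< U Y (nfst a) (seq_decode (nsnd b)) >]]) gen.
- by computability.
- move=> k a; rewrite code_nth_mkseq.
  set e := nfst a; rewrite -(seq_decodeK (nsnd a)).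
  set s := seq_decode _.
  case: (ltnP (w e (seq_code s)) k) => [wk|_]; last by exists 0.
  case: (boolP (X _)) => [_|/wE [f pf sE]]; first by exists 0.
  pose s' := mkseq f (size s).+1.
  have Xs' : ~~ X (w e (seq_code s')) by apply/wE; exists f; rewrite ?size_mkseq.
  pose m := maxn k (w e (seq_code s')).+1.
  exists (npair (str_code (mkseq X m)) (seq_code s')).
  rewrite !npairE /A str_oracleE code_prefix_str code_prefixE seq_codeK.
  rewrite code_nth_mkseq leq_max leqnn orbT (negPf Xs').
  apply/orP; right; apply/and5P; split.
  + by apply/asboolP; case: gen => + _; apply.
  + by apply: prefix_mkseq; apply: leq_maxl.
  + by rewrite /s' {1}sE; apply: prefix_mkseq; apply: leqnSn.
  + apply/eqP => /seq_code_inj /(congr1 size); rewrite size_mkseq => /eqP.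
    by rewrite -[X in X == _]addn0 -addn1 eqn_add2l.
  + by rewrite eqxx /=; apply/asboolP; apply: pf.
(* Iterating this extension step builds a path, so claims of ill-foundedness
   made above [X|k] are true. *)
have sound s e : T s -> prefix (mkseq X k) s ->
    code_nth (str_code s) (w e (seq_code [::])) = 1 -> ~~ hyperjump U Y e.
  move=> Ts ks se; apply/ill_foundedP.
  apply: (@paths_of_extendible _ [set c | exists s, [/\ T s, prefix (mkseq X k) s
    & code_nth (str_code s) (w e (seq_code c)) = 1]]) => //.
    by exists [::], s.
  move=> c [t [Tt kt tc]].
  have [b] := hk t Tt kt (npair e (seq_code c)).
  rewrite !npairE tc eqxx /= => /and5P [/str_oracleP [t' Tt' ->]].
  rewrite -(seq_decodeK (nsnd b)); set c' := seq_decode _.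
  rewrite code_prefix_str code_prefixE seq_decodeK => tt' cc' cn' /andP [/eqP t'c' /asboolP Vc'].
  exists c'; split => //; last by apply: contra cn' => /eqP ->; rewrite seq_decodeK.
  exists t'; split => //; first exact: prefix_trans kt tt'.
  by rewrite seq_decodeK.
(* At the root, which is comparable with all nodes, the claim is about the
   whole of tree [e]. *)
pose v e := w e (seq_code [::]).
have cv : computable A v by rewrite /v; computability.
have vE e : hyperjump U Y e = X (v e).
  apply/idP/idP; last first.
    by apply: contraLR => /ill_foundedP [f pf]; apply/wE; exists f.
  apply: contraLR => /wE [f pf _]; apply/ill_foundedP; by exists f.
(* With [a] coding [(e, t)]: above [X|k'], no string calls tree [e] well-founded
   when some string [t] above [X|k] calls it ill-founded. *)
have [||k' hk'] := @generic_forces T X (fun s a _ =>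
    ~~ [&& code_nth s (v (nfst a)) == 2, A (nsnd a),
        code_prefix (str_code (mkseq X k)) (nsnd a) &
        code_nth (nsnd a) (v (nfst a)) == 1]) gen.
- by computability.
- move=> m a; exists 0; apply/negP => /and4P [/eqP + /str_oracleP [t Tt ->]].
  rewrite code_prefix_str => + kt /eqP /(sound _ _ Tt kt).
  by rewrite code_nth_mkseq vE; case: ifP => // _; case: (X _).
have pathX : paths T X by case: gen.
pose m := maxn k k'.
have km : prefix (mkseq X k) (mkseq X m) by apply: prefix_mkseq; apply: leq_maxl.
have km' : prefix (mkseq X k') (mkseq X m) by apply: prefix_mkseq; apply: leq_maxr.
apply: (@computable_search _ (fun e t => [&& A t,
    code_prefix (str_code (mkseq X m)) t & ~~ (code_nth t (v e) == 0)])
    (fun e t => code_nth t (v e) == 2)).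
- by rewrite /computable2; computability.
- by rewrite /computable2; computability.
- move=> e; pose l := maxn m (v e).+1; exists (str_code (mkseq X l)).
  rewrite /A str_oracleE code_prefix_str prefix_mkseq ?leq_maxl //.
  rewrite code_nth_mkseq leq_max leqnn orbT andbT.
  by apply/asboolP; apply: pathX.
(* The answer of any such string is correct: if it is a wrong claim of
   well-foundedness, then a long initial segment of [X] contradicts it. *)
move=> e t /and3P [/str_oracleP [{}t Tt ->]]; rewrite code_prefix_str => mt.
have kt := prefix_trans km mt; have kt' := prefix_trans km' mt.
case: (boolP (code_nth (str_code t) (v e) == 2)) => [/eqP t2 _|t2 t0];
    last first.
  suff /negPf -> : ~~ hyperjump U Y e by [].
  apply: (sound t) => //; move: t2 t0; rewrite -/(v e) code_nth_str; case: ifP => // _.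
  by case: (nth _ _ _).
suff -> : hyperjump U Y e by [].
rewrite vE; apply: contraT => Xe.
pose l := maxn m (v e).+1.
have [_] := hk' t Tt kt' (npair e (str_code (mkseq X l))).
rewrite !npairE t2 /A str_oracleE code_prefix_str code_nth_mkseq.
rewrite leq_max leqnn orbT (negPf Xe) eqxx prefix_mkseq ?andbT /=; last first.
  by apply: leq_trans (leq_maxl _ _) (leq_maxl _ _).
by move=> /asboolPn; case; apply: pathX.
Qed.

(** * Iterated hyperjumps *)

Fixpoint const_prog (k : nat) : prog :=
  if k is k'.+1 then Comp Succ (const_prog k') else Zero.

Lemma eval_const_prog (A : real) (k n : nat) : eval A (const_prog k) n k.
Proof.
by elim: k => [|k IH] /=; [constructor | apply: eval_Comp IH _; constructor].
Qed.

(** Appending [Succ] to a program acts on its index by a fixed arithmetical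
    operation, which is iterated [k] times from the index [0] of [Zero]. *)
Lemma computable_index_const_prog (A : real) :
  computable A (fun k => index_of (const_prog k)).
Proof.
apply: (@eq_computable _ (fun k => iter k (fun v =>
    let p := npair 1 v in 6 + (p + p + (p + p))) 0)).
  by elim=> //= k ->; rewrite -[4 * _]/((2 * 2) * _) -mulnA !mul2n -!addnn.
apply: (@computable_iter _ (fun _ v =>
    let p := npair 1 v in 6 + (p + p + (p + p)))); rewrite /computable2 /=;
  computability.
Qed.

(** [k] belongs to [Y] exactly when the tree which is empty or full according
    to whether [Y] contains [k] has no path; an index of it is computable from
    [k] because the program deciding it is the composition of a fixed program
    with the numeral for [k]. *)
Lemma reducible_hyperjump (U : real -> nat -> set (seq nat)) (Y : real) :
  effective_tree_indexing Y (U Y) ->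
  exists2 f, computable empty_real f & forall k, Y k = hyperjump U Y (f k).
Proof.
move=> [_ _ [t ht] _].
have [c hc] : computable Y (fun k => ~~ Y k).
  by apply: computable_negb; apply: computable_oracle; apply: computable_id.
pose ind k := index_of (Comp c (const_prog k)).
have cind : computable empty_real ind.
  (* The index of a composition, with multiplication by 4 written as a sum. *)
  apply: (@eq_computable _ (fun k =>
    let p := npair (index_of c) (index_of (const_prog k)) in
    6 + (p + p + (p + p)))).
    move=> k; rewrite /ind /= -[4 * _]/((2 * 2) * _) -mulnA !mul2n -!addnn //.
  have ck := @computable_index_const_prog empty_real.
  by move=> /=; computability.
have [f hf] : {f & forall k, eval empty_real t (ind k) (f k) /\
    paths (U Y (f k)) = paths [set _ : seq nat | ~~ Y k]}.
  apply: (@choice _ _ (fun k e => eval empty_real t (ind k) e /\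
    paths (U Y e) = paths [set _ : seq nat | ~~ Y k])) => k.
  have [||e] := ht (Comp c (const_prog k)) [set _ | ~~ Y k].
  - by move=> s s'.
  - move=> s; apply: eval_Comp (eval_const_prog _ _ _) _.
    by rewrite /= asboolb; apply: hc.
  - by exists e.
exists f => [|k].
  have [ci hci] := cind.
  by exists (Comp t ci) => k; apply: eval_Comp (hci k) _; case: (hf k).
rewrite /hyperjump; have [_ ->] := hf k.
case: (boolP (Y k)) => Yk; apply/esym.
  by apply/asboolP; rewrite -subset0 => x /(_ 0).
apply/negbTE/asboolPn => /(congr1 (fun S => S (fun=> 0))) /= e.
by suff : False by []; rewrite -e => j.
Qed.

Lemma reducible_iter_hyperjump (U : real -> nat -> set (seq nat)) :
  (forall X, effective_tree_indexing X (U X)) ->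
  forall m n, m <= n -> exists2 f, computable empty_real f &
    forall k, iter_hyperjump U m k = iter_hyperjump U n (f k).
Proof.
move=> HU m n /subnKC <-; elim: (n - m) => [|i [f cf hf]].
  by exists id => [|k]; rewrite ?addn0 //; apply: computable_id.
have [g cg hg] := reducible_hyperjump (HU (iter_hyperjump U (m + i))).
exists (g \o f); first exact: computable_comp.
by move=> k; rewrite hf hg addnS.
Qed.

Theorem corollary4p3
    (U : real -> nat -> set (seq nat))
    (HU : forall X : real, effective_tree_indexing X (U X))
    (n : nat) (T : set (seq bool)) (HT : perfect_tree T) :
  ~ two_generic T (iter_hyperjump U n).
Proof.
move=> gen; apply: (generic_not_computable HT gen).
suff H m : m <= n ->
    computable (str_oracle T) (fun k => iter_hyperjump U m k) by exact: H.
elim: m => [_|m IH mn]; first exact: computable_const.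
have [f cf hf] := reducible_iter_hyperjump HU mn.
apply: (hyperjump_computable (HU _) gen (IH (ltnW mn)) _ hf).
by apply: computable_trans cf; apply: computable_const.
Qed.
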